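(* For all $0\le i\le\min(k,2+m)$, $$\Gamma_i^{[1;1+m]\times k}=(2^k-2^{i-1})\Gamma_{i-1}^{(1+m)\times k}+2^i\Gamma_i^{(1+m)\times k}$$ (with $\Gamma_{-1}^{(1+m)\times k}=0$). Moreover: (a) if $k=2$: $\Gamma_0^{[1;1+m]\times 2}=1$, $\Gamma_1^{[1;1+m]\times 2}=9$, $\Gamma_2^{[1;1+m]\times 2}=2^{4+m}-10$; (b) if $m=0$, $k\ge2$: $\Gamma_0^{[1;1]\times k}=1$, $\Gamma_1^{[1;1]\times k}=3(2^k-1)$, $\Gamma_2^{[1;1]\times k}=2^{2k}-3\cdot2^k+2$; (c) if $m=1$, $k\ge3$: $\Gamma_0^{[1;2]\times k}=1$, $\Gamma_1^{[1;2]\times k}=2^k+5$, $\Gamma_2^{[1;2]\times k}=11(2^k-2)$, $\Gamma_3^{[1;2]\times k}=2^{2k+1}-3\cdot2^{k+2}+2^4$; (d) if $3\le k\le 1+m$: $\Gamma_0^{[1;1+m]\times k}=1$, $\Gamma_1^{[1;1+m]\times k}=2^k+5$, $\Gamma_i^{[1;1+m]\times k}=3\cdot2^{k+2i-4}+21\cdot2^{3i-5}$ for $2\le i\le k-1$, and $\Gamma_k^{[1;1+m]\times k}=2^{2k+m}-5\cdot2^{3k-5}$; (e) if $2\le m\le k-2$: $\Gamma_0^{[1;1+m]\times k}=1$, $\Gamma_1^{[1;1+m]\times k}=2^k+5$, $\Gamma_i^{[1;1+m]\times k}=3\cdot2^{k+2i-4}+21\cdot2^{3i-5}$ for $2\le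 i\le m$, $\Gamma_{m+1}^{[1;1+m]\times k}=11\,(2^{k+2m-2}-2^{3m-2})$, and $\Gamma_{m+2}^{[1;1+m]\times k}=2^{2k+m}-3\cdot2^{k+2m}+2^{3m+1}$.
   Context: $k\ge1$, $m\ge0$ are integers. $\Gamma_i^{(1+m)\times k}$ is the number of $(1+m)\times k$ persymmetric matrices $(\alpha_{i+j-1})$ over $\mathbb{F}_2$ of rank $i$. $\Gamma_i^{[1;1+m]\times k}$ is the number of $(2+m)\times k$ matrices over $\mathbb{F}_2$ of the form $\left[\begin{smallmatrix}A\\ b\end{smallmatrix}\right]$ with $A$ a $(1+m)\times k$ persymmetric matrix and $b$ an arbitrary row in $\mathbb{F}_2^k$, having rank $i$. *)

(* Defs.v *)
From HB Require Import structures.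
From mathcomp Require Import all_boot all_order all_algebra.

Set Implicit Arguments.
Unset Strict Implicit.
Unset Printing Implicit Defensive.

Import Order.TTheory GRing.Theory Num.Theory.
Local Open Scope ring_scope.

(* Rows, columns and alpha are numbered from 0, so the entry alpha_(i+j-1) of
   the 1-based convention becomes alpha`_(i + j); the index i + j is always
   below (s + k).-1, the length of alpha. *)
Definition persymmetric (s k : nat) (A : 'M['F_2]_(s, k)) : bool :=
  [exists alpha : ((s + k).-1).-tuple 'F_2,
     A == \matrix_(i < s, j < k) alpha`_(i + j)].

Definition persymmetric_plus_row (s k : nat) (M : 'M['F_2]_(s + 1, k)) : bool :=
  [exists A : 'M['F_2]_(s, k), exists b : 'rV['F_2]_k,
     persymmetric A && (M == col_mx A b)].

(* The rank i is an integer, so that Gamma s k (-1) makes sense (and is 0). *)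
Definition Gamma (s k : nat) (i : int) : nat :=
  #|[set A : 'M['F_2]_(s, k) | persymmetric A & (\rank A)%:Z == i]|.

(* Gamma1 s k i stands for Gamma_i^{[1; s] x k}. *)
Definition Gamma1 (s k : nat) (i : int) : nat :=
  #|[set M : 'M['F_2]_(s + 1, k) |
      persymmetric_plus_row M & (\rank M)%:Z == i]|.

(* Main.v *)
Require Import Defs.
From HB Require Import structures.
From mathcomp Require Import all_boot all_order all_algebra mxabelem.
From mathcomp Require Import zify ring lra.

(** Fix a sequence of length n and let f(j) be the dimension of the left kernel
    of its j x (n + 1 - j) Hankel matrix.  Identifying a row vector with a
    polynomial p of degree < j, padding p with a zero and multiplying p by the
    variable both map the j-th kernel K_j into K_(j+1), and the two images meet
    in a copy of K_(j-1); hence f is convex.  Transposition gives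
    f(n + 1 - j) = f(j) + n + 1 - 2j, so on the first half of the range the
    slopes of f are a block of 0's followed by a block of 1's.  Thus, for
    r < min(s, k), the s x k Hankel matrix has rank at most r iff f(r + 1) > 0,
    in which case f(r + 1) = f(r) + 1.  On the other hand a nonzero polynomial
    lies in K_j for exactly q^(j-1) sequences over F_q, which gives the sum of
    q^f(j) over all sequences; comparing j = r and j = r + 1 shows that exactly
    q^(2r) sequences have rank at most r.  Finally, appending a row b to A
    keeps the rank iff b lies in the row space of A, of size 2^rank(A). *)

Set Implicit Arguments.
Unset Strict Implicit.
Unset Printing Implicit Defensive.

Import Order.TTheory GRing.Theory Num.Theory.
Local Open Scope ring_scope.

(** * Left kernels of Hankel matrices and shifts *)

Section HankelKernel.

Variable F : fieldType.
Implicit Type a : nat -> F.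

Definition hankel s k a : 'M[F]_(s, k) := \matrix_(i < s, j < k) a (i + j)%N.

Lemma tr_hankel s k a : (hankel s k a)^T = hankel k s a.
Proof. by apply/matrixP=> i j; rewrite !mxE addnC. Qed.

(* In coordinates, d = 0 pads a row vector with a last zero, and d = 1 with a
   first zero. *)
Definition shiftmx (d s : nat) : 'M[F]_(s, s.+1) :=
  \matrix_(i < s, j < s.+1) (j == (i + d)%N :> nat)%:R.

Lemma mul_shiftmx d s k (A : 'M[F]_(s.+1, k)) (i : 'I_s) (i' : 'I_s.+1) j :
  i' = (i + d)%N :> nat -> (shiftmx d s *m A) i j = A i' j.
Proof.
move=> ei; rewrite mxE (bigD1 i') //= mxE ei eqxx mul1r big1 ?addr0 // => l.
by rewrite mxE -val_eqE /= ei => /negPf->; rewrite mul0r.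
Qed.

Lemma shiftmx_hankel d s k a (i : 'I_s) (j : 'I_k) : (d <= 1)%N ->
  (shiftmx d s *m hankel s.+1 k a) i j = a (i + d + j)%N.
Proof.
move=> d1; have lt_i : (i + d < s.+1)%N by have := ltn_ord i; lia.
by rewrite (@mul_shiftmx _ _ _ _ _ (Ordinal lt_i)) // mxE.
Qed.

Lemma row_free_shiftmx d s : (d <= 1)%N -> row_free (shiftmx d s).
Proof.
move=> d1; apply/row_freeP; exists (shiftmx d s)^T.
apply/matrixP=> i j; have lt_i : (i + d < s.+1)%N by have := ltn_ord i; lia.
by rewrite (@mul_shiftmx _ _ _ _ _ (Ordinal lt_i)) // !mxE eqn_add2r.
Qed.

Lemma mul_hankelE m s k a (V : 'M[F]_(m, s)) i (j : 'I_k) :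
  (V *m hankel s k a) i j = \sum_l V i l * a (l + j)%N.
Proof. by rewrite mxE; apply: eq_bigr => l _; rewrite mxE. Qed.

Lemma mul_shiftmx_hankelE d m s k a (V : 'M[F]_(m, s)) i (j : 'I_k) :
  (d <= 1)%N ->
  (V *m shiftmx d s *m hankel s.+1 k a) i j = \sum_l V i l * a (l + d + j)%N.
Proof.
move=> d1; rewrite -mulmxA mxE.
by apply: eq_bigr => l _; rewrite shiftmx_hankel.
Qed.

(** Column [j] pairs with the shifted rows as column [d + j] of the wider matrix pairs with the
    original ones; its extra column makes room for [d = 1]. *)
Lemma shiftmx_ker d s k a m (V : 'M[F]_(m, s)) : (d <= 1)%N ->
  V *m hankel s k.+1 a = 0 -> V *m shiftmx d s *m hankel s.+1 k a = 0.
Proof.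
move=> d1 V0; apply/matrixP=> i j.
have lt_j : (d + j < k.+1)%N by have := ltn_ord j; lia.
have /matrixP/(_ i (Ordinal lt_j)) := V0; rewrite mul_hankelE /= mxE => V0ij.
rewrite mul_shiftmx_hankelE // mxE -[RHS]V0ij.
by apply: eq_bigr => l _; rewrite addnA.
Qed.

Lemma mulmx_shiftr d s (v : 'rV[F]_s) (i : 'I_s) (j : 'I_s.+1) :
  j = (i + d)%N :> nat -> (v *m shiftmx d s) 0 j = v 0 i.
Proof.
move=> ej; rewrite mxE (bigD1 i) //= mxE ej eqxx mulr1 big1 ?addr0 // => l.
by rewrite mxE -val_eqE /= ej eqn_add2r eq_sym => /negPf->; rewrite mulr0.
Qed.

Lemma mulmx_shift0_max s (v : 'rV[F]_s) : (v *m shiftmx 0 s) 0 ord_max = 0.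
Proof.
rewrite mxE big1 // => l _; rewrite mxE /= addn0.
by rewrite gtn_eqF ?mulr0 // ltn_ord.
Qed.

Lemma mulmx_shift1_0 s (v : 'rV[F]_s) : (v *m shiftmx 1 s) 0 ord0 = 0.
Proof. by rewrite mxE big1 // => l _; rewrite mxE /= addn1 mulr0. Qed.

(** As polynomials, u = X v with u and v of degree at most s, so u has no constant term and v has no
    coefficient of degree s. The witness p is v without its last entry. *)
Lemma shiftmx_cap s (u v : 'rV[F]_s.+1) :
  u *m shiftmx 0 s.+1 = v *m shiftmx 1 s.+1 ->
  exists p, u = p *m shiftmx 1 s /\ v = p *m shiftmx 0 s.
Proof.
move=> euv; have ec j := congr1 (fun M : 'rV_(_) => M 0 j) euv.
exists (\row_i v 0 (widen_ord (leqnSn s) i)); split; apply/rowP=> j.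
  have := ec (widen_ord (leqnSn _) j).
  rewrite (@mulmx_shiftr _ _ _ j) ?addn0 //.
  case: (unliftP ord0 j) => [i|] -> ->; last first.
    rewrite mulmx_shift1_0 -[RHS](mulmx_shift1_0 v).
    by congr (_ _ _); apply: val_inj.
  have lift0i : lift ord0 i = (i + 1)%N :> nat by rewrite lift0 addn1.
  rewrite [RHS](mulmx_shiftr _ lift0i) mxE.
  by apply: mulmx_shiftr; rewrite /= -lift0i.
case: (unliftP ord_max j) => [i|] ->; last first.
  rewrite mulmx_shift0_max -(@mulmx_shiftr 1 _ _ _ ord_max) -?ec /= ?addn1 //.
  exact: mulmx_shift0_max.
rewrite (@mulmx_shiftr _ _ _ i) ?mxE; last by rewrite lift_max addn0.
by congr (v _ _); apply: val_inj; rewrite /= /bump leqNgt ltn_ord.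
Qed.

(** The padded p gives the first k + 1 of the k + 2 equations, and the shifted p gives the last
    one. *)
Lemma hankel_ker_split s k a (p : 'rV[F]_s) :
    p *m shiftmx 0 s *m hankel s.+1 k.+1 a = 0 ->
    p *m shiftmx 1 s *m hankel s.+1 k.+1 a = 0 ->
  p *m hankel s k.+2 a = 0.
Proof.
move=> p0 p1; apply/rowP=> j; rewrite mul_hankelE mxE.
case: (unliftP ord_max j) => [i|] ->.
  have /rowP/(_ i) := p0; rewrite mul_shiftmx_hankelE // mxE => p0i.
  rewrite -[RHS]p0i.
  by apply: eq_bigr => l _; rewrite addn0 lift_max.
have /rowP/(_ ord_max) := p1; rewrite mul_shiftmx_hankelE // mxE => p1k.
rewrite -[RHS]p1k.
by apply: eq_bigr => l _; rewrite /= addn1 addSnnS.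
Qed.

Lemma rank_ker_hankel_convex s k a :
  (2 * \rank (kermx (hankel s.+1 k.+1 a)) <=
   \rank (kermx (hankel s.+2 k a)) + \rank (kermx (hankel s k.+2 a)))%N.
Proof.
set K := kermx (hankel s.+1 k.+1 a).
set U := K *m shiftmx 0 s.+1; set V := K *m shiftmx 1 s.+1.
have rU : \rank U = \rank K by rewrite mxrankMfree ?row_free_shiftmx.
have rV : \rank V = \rank K by rewrite mxrankMfree ?row_free_shiftmx.
rewrite mul2n -addnn -{1}rU -rV -mxrank_sum_cap leq_add //.
  apply: mxrankS; rewrite addsmx_sub !sub_kermx.
  by rewrite !shiftmx_ker ?mulmx_ker ?eqxx.
(* [W] is the copy of the smaller kernel, embedded by p -> X p, that contains the intersection of
   [U] and [V]. *)
pose W := kermx (hankel s k.+2 a) *m shiftmx 0 s *m shiftmx 1 s.+1.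
have <- : \rank W = \rank (kermx (hankel s k.+2 a)).
  by rewrite 2?mxrankMfree ?row_free_shiftmx.
apply/mxrankS/rV_subP => w; rewrite sub_capmx => /andP[/submxP[u]].
rewrite /U (mulmxA u K) => -> /submxP[v]; rewrite /V (mulmxA v K) => euv.
have [p [eu ev]] := shiftmx_cap euv; rewrite euv ev submxMr // submxMr //.
rewrite sub_kermx; apply/eqP/hankel_ker_split.
  by rewrite -ev -(mulmxA v) mulmx_ker mulmx0.
by rewrite -eu -(mulmxA u) mulmx_ker mulmx0.
Qed.

End HankelKernel.

(** * Convex sequences of naturals with a reflection symmetry *)

Section ConvexSymmetric.

Variables (n : nat) (f : nat -> nat).
Hypothesis f_convex : forall j, (j < n)%N -> (2 * f j.+1 <= f j.+2 + f j)%N.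
Hypothesis f_sym :
  forall j, (j <= n.+1)%N -> (f (n.+1 - j) + 2 * j = n.+1 + f j)%N.

(** Chained convexity: slopes are monotone. The form is additive because subtraction on [nat]
    truncates. *)
Lemma convex_slope_le i j : (i <= j <= n)%N -> (f i.+1 + f j <= f j.+1 + f i)%N.
Proof.
case/andP=> /subnKC <-; elim: (j - i)%N => [|l IH] lt_n; first by rewrite addn0.
have := f_convex (j := i + l); have := IH; rewrite !addnS in lt_n *; lia.
Qed.

(** By symmetry the slopes at r and n - r add up to 2, and by convexity the former is at most the
    latter. *)
Lemma convex_sym_slope_le1 r : (2 * r <= n)%N -> (f r.+1 <= (f r).+1)%N.
Proof.
move=> le_rn; have := @convex_slope_le r (n - r).
have := f_sym (j := r); have := f_sym (j := r.+1); rewrite subSS.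
rewrite -subSn; lia.
Qed.

Lemma convex_sym_le_addl r t :
  (2 * (r + t) <= n.+1)%N -> (f (r + t) <= f r + t)%N.
Proof.
elim: t => [|t IH] le_n; first by rewrite !addn0.
have := @convex_sym_slope_le1 (r + t); have := IH; rewrite !addnS; lia.
Qed.

Hypothesis f0 : f 0 = 0%N.

Lemma convex_le_succ j : (j <= n)%N -> (f j <= f j.+1)%N.
Proof. by move=> le_jn; have := @convex_slope_le 0 j; lia. Qed.

(** Were the slope at r not positive, no earlier slope would be, and f would vanish from 0 up to r +
    1. *)
Lemma convex_sym_slope1 r :
  (2 * r <= n)%N -> (0 < f r.+1)%N -> f r.+1 = (f r).+1.
Proof.
move=> le_rn fr_gt0; apply/eqP; rewrite eqn_leq convex_sym_slope_le1 //=.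
rewrite ltnNge; apply/negP=> le_fr.
suff: forall j, (j <= r.+1)%N -> f j = 0%N by move/(_ r.+1 (leqnn _)); lia.
elim=> [//|j IH] lt_jr; have := @convex_slope_le j r; have := IH (ltnW lt_jr).
lia.
Qed.

Lemma convex_sym_eq_addl r t :
  (2 * (r + t) <= n.+1)%N -> (0 < f r)%N -> f (r + t) = (f r + t)%N.
Proof.
elim: t => [|t IH] le_n fr_gt0; first by rewrite !addn0.
have := @convex_sym_slope1 (r + t); have := @convex_le_succ (r + t); have := IH.
rewrite !addnS; lia.
Qed.

End ConvexSymmetric.

(** * Rank of a Hankel matrix read off from kernel dimensions *)

Section HankelRank.

Variable F : fieldType.

(** The f of the overview: for 1 <= j <= n the matrices all use the same entries [a 0], ...,
    [a (n - 1)]. *)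
Definition hankel_nullity n j (a : nat -> F) : nat :=
  \rank (kermx (hankel j (n.+1 - j) a)).

Lemma hankel_nullity_convex n j a : (j < n)%N ->
  (2 * hankel_nullity n j.+1 a <=
     hankel_nullity n j.+2 a + hankel_nullity n j a)%N.
Proof.
move=> lt_jn; rewrite /hankel_nullity.
have [k ->] : exists k, n = (j + k).+1 by exists (n - j.+1)%N; lia.
have -> : ((j + k).+2 - j.+2)%N = k by lia.
have -> : ((j + k).+2 - j.+1)%N = k.+1 by lia.
have -> : ((j + k).+2 - j)%N = k.+2 by lia.
exact: rank_ker_hankel_convex.
Qed.

(** The two matrices are transposes of each other, so their ranks agree and their nullities differ
    as their heights do. *)
Lemma hankel_nullity_sym n j a : (j <= n.+1)%N ->
  (hankel_nullity n (n.+1 - j) a + 2 * j = n.+1 + hankel_nullity n j a)%N.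
Proof.
move=> le_jn; rewrite /hankel_nullity subKn // !mxrank_ker.
rewrite -[\rank (hankel (n.+1 - j) j a)]mxrank_tr tr_hankel.
have := rank_leq_row (hankel j (n.+1 - j) a).
have := rank_leq_col (hankel j (n.+1 - j) a); lia.
Qed.

Lemma hankel_nullity0 n a : hankel_nullity n 0 a = 0%N.
Proof. by apply/eqP; rewrite -leqn0 rank_leq_row. Qed.

Lemma hankel_nullityS n r a : (2 * r <= n)%N ->
  (0 < hankel_nullity n r.+1 a)%N ->
  hankel_nullity n r.+1 a = (hankel_nullity n r a).+1.
Proof.
apply: (convex_sym_slope1 (f := hankel_nullity n ^~ a)) => [j|j|].
- exact: hankel_nullity_convex.
- exact: hankel_nullity_sym.
- exact: hankel_nullity0.
Qed.

Lemma hankel_nullity_le_succ n r a : (r <= n)%N ->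
  (hankel_nullity n r a <= hankel_nullity n r.+1 a)%N.
Proof.
apply: (convex_le_succ (f := hankel_nullity n ^~ a)) => [j|].
- exact: hankel_nullity_convex.
- exact: hankel_nullity0.
Qed.

(** For s <= k the rank is s - f(s). If f(r + 1) > 0, the slopes from r + 1 to s are all 1 and f(s)
    >= s - r; if f(r + 1) = 0, slopes at most 1 give f(s) <= s - r - 1. *)
Lemma rank_hankel_le n s k r a : (s + k = n.+1)%N -> (r < s)%N -> (r < k)%N ->
  (\rank (hankel s k a) <= r)%N = (0 < hankel_nullity n r.+1 a)%N.
Proof.
wlog le_sk : s k / (s <= k)%N => [hw sk rs rk|sk rs rk].
  case/orP: (leq_total s k) => [/hw->//|/hw <-//]; last by rewrite addnC.
  by rewrite -[in RHS]mxrank_tr tr_hankel.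
have f_conv := @hankel_nullity_convex n ^~ a.
have f_sym := @hankel_nullity_sym n ^~ a.
have f0 := hankel_nullity0 n a.
have ks : k = (n.+1 - s)%N by lia.
have [t st] : exists t, s = (r.+1 + t)%N by exists (s - r.+1)%N; lia.
have := @convex_sym_le_addl n (hankel_nullity n ^~ a) f_conv f_sym r.+1 t.
have := @convex_sym_eq_addl n (hankel_nullity n ^~ a) f_conv f_sym f0 r.+1 t.
rewrite -st {2 4}/hankel_nullity mxrank_ker -ks.
have := rank_leq_row (hankel s k a); lia.
Qed.

End HankelRank.

(** * Counting Hankel matrices over a finite field *)

Section HankelCount.

Variable F : finFieldType.
Local Notation q := #|F|.

Lemma card_rV n : #|{: 'rV[F]_n}| = (q ^ n)%N.
Proof. by rewrite card_mx mul1n. Qed.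

(** For fixed u, multiplying u by the Hankel matrix of x is linear in x; this is the matrix of that
    map. *)
Definition convolution_mx n k s (u : 'rV[F]_s) : 'M[F]_(n, k) :=
  \matrix_(l < n, j < k) \sum_(i < s) u 0 i * (l == (i + j)%N :> nat)%:R.

(** [rVpoly x] drops the trailing zeros of x; the default value 0 of [nth] restores them. *)
Lemma mul_convolution_mx n k s (u : 'rV[F]_s) (x : 'rV[F]_n) :
  (s + k = n.+1)%N ->
  x *m convolution_mx n k u = u *m hankel s k (nth 0%R (rVpoly x)).
Proof.
move=> sk; apply/rowP=> j; rewrite mul_hankelE mxE.
under eq_bigr => l _ do rewrite mxE mulr_sumr.
rewrite exchange_big; apply: eq_bigr => i _ /=.
have lt_ij : (i + j < n)%N by have := ltn_ord i; have := ltn_ord j; lia.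
rewrite (bigD1 (Ordinal lt_ij)) //= eqxx mulr1 big1 ?addr0 => [|l].
  by rewrite mulrC -(coef_rVpoly_ord x (Ordinal lt_ij)).
by rewrite -val_eqE /= => /negPf->; rewrite !mulr0.
Qed.

Lemma rVpoly_sum n (x : 'rV[F]_n) : rVpoly x = \sum_i x 0 i *: 'X^i.
Proof.
rewrite {1}[x]row_sum_delta linear_sum /=.
by apply: eq_bigr => i _; rewrite linearZ /= rVpoly_delta.
Qed.

(* The transpose acts as multiplication by the polynomial of u, hence is
   injective when u is nonzero. *)
Lemma rank_convolution_mx n k s (u : 'rV[F]_s) :
  (s + k = n.+1)%N -> u != 0 -> \rank (convolution_mx n k u) = k.
Proof.
move=> sk nzu; apply/eqP; rewrite -mxrank_tr -/(row_free _) -kermx_eq0.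
apply/rowV0P => v /sub_kermxP v0.
suff: rVpoly v * rVpoly u = 0.
  move/eqP; rewrite mulf_eq0 => /orP[/eqP pv0|/eqP pu0].
    by rewrite -[v]rVpolyK pv0 linear0.
  by case/eqP: nzu; rewrite -[u]rVpolyK pu0 linear0.
apply/polyP=> l; rewrite coef0 !rVpoly_sum mulr_suml coef_sum.
have [lt_ln|le_nl] := ltnP l n.
  have /rowP/(_ (Ordinal lt_ln)) := v0; rewrite !mxE => e; rewrite -[RHS]e.
  apply: eq_bigr => j _; rewrite !mxE mulr_sumr coef_sum mulr_sumr.
  apply: eq_bigr => i _ /=.
  by rewrite -scalerAl -scalerAr -exprD !coefZ coefXn addnC.
(* The degrees add up to at most (k - 1) + (s - 1) = n - 1. *)
rewrite big1 // => j _; rewrite mulr_sumr coef_sum big1 // => i _.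
rewrite -scalerAl -scalerAr -exprD !coefZ coefXn gtn_eqF ?mulr0 //.
by have := ltn_ord i; have := ltn_ord j; lia.
Qed.

(** Double counting of the pairs (u, x) with u in the left kernel of the matrix of x: u = 0 allows
    every x, and any other u allows q^(n - k) of them by rank-nullity. *)
Lemma sum_card_ker_hankel n s k : (s + k = n.+1)%N ->
  (\sum_(x : 'rV[F]_n) q ^ \rank (kermx (hankel s k (nth 0%R (rVpoly x))))
   = q ^ n + (q ^ s - 1) * q ^ (n - k))%N.
Proof.
move=> sk; pose H (x : 'rV[F]_n) := hankel s k (nth 0%R (rVpoly x)).
transitivity (\sum_(u : 'rV[F]_s) #|[set x | u *m H x == 0%R]|)%N.
  under eq_bigr => x _ do
    rewrite -card_rowg -sum1_card big_mkcond /=.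
  rewrite exchange_big; apply: eq_bigr => u _ /=.
  rewrite -sum1dep_card [RHS]big_mkcond; apply: eq_bigr => x _.
  by rewrite mem_rowg sub_kermx.
rewrite (bigD1 0%R) //=; congr (_ + _)%N.
  rewrite -card_rV -cardsT; apply: eq_card => x.
  by rewrite !inE mul0mx eqxx.
rewrite (eq_bigr (fun=> q ^ (n - k))%N) => [|u nzu].
  rewrite sum_nat_const; congr (_ * _)%N.
  rewrite -card_rV subn1 -(cardC1 0%R).
  by apply: eq_card => u; rewrite !inE.
rewrite -[in RHS](rank_convolution_mx sk nzu) -mxrank_ker -card_rowg.
by apply: eq_card => x; rewrite mem_rowg inE sub_kermx mul_convolution_mx.
Qed.

Lemma card_hankel_rank_le n s k r :
    (s + k = n.+1)%N -> (r < s)%N -> (r < k)%N ->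
  #|[set x : 'rV[F]_n | (\rank (hankel s k (nth 0%R (rVpoly x))) <= r)%N]|
  = (q ^ (2 * r))%N.
Proof.
move=> sk rs rk; set C := #|_|; pose Z := (q ^ n - C)%N.
pose f j (x : 'rV[F]_n) := hankel_nullity n j (nth 0%R (rVpoly x)).
have eC : C = #|[set x | (0 < f r.+1 x)%N]|.
  by apply: eq_card => x; rewrite !inE (rank_hankel_le _ sk).
have eZ : #|[set x | f r.+1 x == 0%N]| = Z.
  rewrite /Z -card_rV -cardsT eC -cardsDS ?subsetT //.
  by apply: eq_card => x; rewrite !inE andbT -leqNgt leqn0.
have CZ : (q ^ n = C + Z)%N.
  by rewrite subnKC // -card_rV max_card.
have q1 : (1 < q)%N := card_finNzRing_gt1 F.
(* Either f(r + 1) = f(r) + 1, or both vanish and the identity reads q = 1 + (q - 1). *)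
have step x : (q * q ^ f r x = q ^ f r.+1 x + (q - 1) * (f r.+1 x == 0%N))%N.
  have [f0|] := posnP (f r.+1 x).
    have fr0 : f r x = 0%N.
      by apply/eqP; rewrite -leqn0 -f0 hankel_nullity_le_succ; lia.
    by rewrite f0 fr0 expn0 !muln1; lia.
  move=> fpos; rewrite muln0 addn0 -expnS; congr (q ^ _)%N.
  by rewrite /f hankel_nullityS //; lia.
(* Sum of [step] over all x, with the kernel sums at r and r + 1 inserted. *)
have sums : (q * (q ^ n + (q ^ r - 1) * q ^ (n - (n.+1 - r)))
  = q ^ n + (q ^ r.+1 - 1) * q ^ (n - (n.+1 - r.+1)) + (q - 1) * Z)%N.
  rewrite -!sum_card_ker_hankel; try lia.
  rewrite -eZ -sum1dep_card [X in (_ = _ + _ * X)%N]big_mkcond !big_distrr.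
  rewrite -big_split /=.
  by apply: eq_bigr => x _; rewrite [LHS]step; case: eqP.
(* The exponent is r - 1; it truncates at r = 0, where the factor q^r - 1 vanishes. *)
have e1 : (q * ((q ^ r - 1) * q ^ (n - (n.+1 - r))) = (q ^ r - 1) * q ^ r)%N.
  case: r rs rk {C Z f eC eZ CZ step sums} => [|r] rs rk.
    by rewrite muln0.
  by rewrite mulnCA -expnS; congr (_ * q ^ _)%N; lia.
(* With Q = q^r the identity reduces to (q - 1) C = (q - 1) Q^2. Writing q and Q as successors
   removes the subtractions before p = q - 1 is cancelled. *)
move: sums; rewrite mulnDr e1 CZ subSS subKn; last by lia.
have : (0 < q ^ r)%N by rewrite expn_gt0 (ltnW q1).
rewrite mul2n -addnn expnD expnS.
case: (q ^ r)%N q1 => // x; case: q => // p p_gt0 _ e; apply/eqP.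
by rewrite -(eqn_pmul2l (m := p)) //; apply/eqP; lia.
Qed.

End HankelCount.

(** * Persymmetric matrices over F_2 by rank *)

Section Persymmetric.

Variables s k : nat.

Lemma persymmetricP (A : 'M['F_2]_(s, k)) : (0 < s)%N -> (0 < k)%N ->
  reflect (exists x : 'rV_((s + k).-1), A = hankel s k (nth 0 (rVpoly x)))
          (persymmetric A).
Proof.
move=> s0 k0; have lt_n (i : 'I_s) (j : 'I_k) : (i + j < (s + k).-1)%N.
  by have := ltn_ord i; have := ltn_ord j; lia.
apply: (iffP existsP) => [[t /eqP ->]|[x ->]].
  exists (\row_i t`_i); apply/matrixP=> i j; rewrite !mxE.
  by rewrite (coef_rVpoly_ord _ (Ordinal (lt_n i j))) mxE.
exists [tuple x 0 i | i < (s + k).-1]; apply/eqP/matrixP=> i j; rewrite !mxE.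
rewrite (coef_rVpoly_ord _ (Ordinal (lt_n i j))).
by rewrite -[RHS](tnth_nth 0 _ (Ordinal (lt_n i j))) tnth_mktuple.
Qed.

Lemma hankel_rVpoly_inj (F : fieldType) : (0 < s)%N -> (0 < k)%N ->
  injective (fun x : 'rV[F]_((s + k).-1) => hankel s k (nth 0 (rVpoly x))).
Proof.
move=> s0 k0 x y exy; apply/rowP=> l.
(* Entry l of the sequence is read down the first column, then along the last row. *)
have lt_i : (minn l s.-1 < s)%N by lia.
have lt_j : (l - minn l s.-1 < k)%N by have := ltn_ord l; lia.
have /matrixP/(_ (Ordinal lt_i) (Ordinal lt_j)) := exy.
by rewrite !mxE /= subnKC ?geq_minl // !coef_rVpoly_ord.
Qed.

Lemma card_persymmetric (P : pred 'M['F_2]_(s, k)) : (0 < s)%N -> (0 < k)%N ->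
  #|[set A | persymmetric A & P A]| =
  #|[set x : 'rV_((s + k).-1) | P (hankel s k (nth 0%R (rVpoly x)))]|.
Proof.
move=> s0 k0; rewrite -(card_imset _ (hankel_rVpoly_inj s0 k0)).
apply: eq_card => A; rewrite inE; apply/andP/imsetP.
  by case=> /(persymmetricP _ s0 k0)[x ->] PA; exists x; rewrite ?inE.
case=> x; rewrite inE => Px ->; split=> //.
by apply/persymmetricP=> //; exists x.
Qed.

Lemma card_persymmetric_rank_le r : (r < minn s k)%N ->
  #|[set A : 'M['F_2]_(s, k) | persymmetric A & (\rank A <= r)%N]| = (4 ^ r)%N.
Proof.
rewrite leq_min => /andP[rs rk]; rewrite card_persymmetric; try lia.
rewrite card_hankel_rank_le ?card_Fp ?expnM //; lia.
Qed.

(** The rank bound always holds, so every sequence counts; it is kept to match the form of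
    [card_persymmetric_rank_leS]. *)
Lemma card_persymmetric_all : (0 < minn s k)%N ->
  #|[set A : 'M['F_2]_(s, k) | persymmetric A & (\rank A <= minn s k)%N]|
  = (2 ^ (s + k).-1)%N.
Proof.
rewrite leq_min => /andP[s0 k0]; rewrite card_persymmetric //.
transitivity #|{: 'rV['F_2]_((s + k).-1)}|; last by rewrite card_rV card_Fp.
rewrite -cardsT; apply: eq_card => x.
by rewrite !inE leq_min rank_leq_row rank_leq_col.
Qed.

Lemma Gamma_nat (r : nat) :
  Gamma s k r = #|[set A : 'M['F_2]_(s, k) | persymmetric A & \rank A == r]|.
Proof. by apply: eq_card => A; rewrite !inE eqz_nat. Qed.

Lemma card_persymmetric_rank_leS r :
  #|[set A : 'M['F_2]_(s, k) | persymmetric A & (\rank A <= r.+1)%N]| =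
  (#|[set A : 'M['F_2]_(s, k) | persymmetric A & (\rank A <= r)%N]|
   + Gamma s k r.+1)%N.
Proof.
rewrite Gamma_nat -!sum1dep_card [LHS](bigID (fun A => (\rank A <= r)%N)) /=.
congr (_ + _)%N; apply: eq_bigl => A; rewrite -andbA; congr (_ && _); lia.
Qed.

Lemma Gamma_eq0 (r : nat) : (minn s k < r)%N -> Gamma s k r = 0%N.
Proof.
move=> lt_r; rewrite Gamma_nat; apply: eq_card0 => A; rewrite !inE.
have := rank_leq_row A; have := rank_leq_col A; lia.
Qed.

Lemma Gamma0 : (0 < minn s k)%N -> Gamma s k 0 = 1%N.
Proof.
move=> s0; rewrite -(expn0 4) -card_persymmetric_rank_le // Gamma_nat.
by apply: eq_card => A; rewrite !inE leqn0.
Qed.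

(** This is 4^(r + 1) - 4^r. *)
Lemma GammaS_lt r : (r.+1 < minn s k)%N -> Gamma s k r.+1 = (3 * 4 ^ r)%N.
Proof.
move=> lt_r; have := card_persymmetric_rank_leS r.
by rewrite !card_persymmetric_rank_le 1?expnS; lia.
Qed.

Lemma GammaS_full r : r.+1 = minn s k ->
  (Gamma s k r.+1 + 4 ^ r = 2 ^ (s + k).-1)%N.
Proof.
move=> er; have := card_persymmetric_rank_leS r.
by rewrite {1}er card_persymmetric_all ?card_persymmetric_rank_le; lia.
Qed.

End Persymmetric.

(** * Appending an arbitrary row *)

Lemma rank_col_mx_row (F : fieldType) s k (A : 'M[F]_(s, k)) (b : 'rV[F]_k) :
  \rank (col_mx A b) = (\rank A + ~~ (b <= A)%MS)%N.
Proof.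
rewrite -addsmxE; case: (boolP (b <= A)%MS) => [sbA|nsbA].
  by rewrite addn0 (addsmx_idPl sbA).
apply/eqP; rewrite eqn_leq; apply/andP; split.
  by rewrite (leq_trans (mxrank_adds_leqif _ _)) // leq_add2l rank_leq_row.
rewrite addn1 (ltn_leqif (mxrank_leqif_sup (addsmxSl A b))).
by rewrite addsmx_sub submx_refl.
Qed.

Lemma card_rank_col_mx_row (F : finFieldType) s k (A : 'M[F]_(s, k)) i :
  #|[set b : 'rV[F]_k | \rank (col_mx A b) == i]| =
  ((\rank A == i) * #|F| ^ \rank A
   + ((\rank A).+1 == i) * (#|F| ^ k - #|F| ^ \rank A))%N.
Proof.
have in_card : #|[set b : 'rV[F]_k | (b <= A)%MS]| = (#|F| ^ \rank A)%N.
  exact: card_rowg.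
have out_card :
    #|[set b : 'rV[F]_k | ~~ (b <= A)%MS]| = (#|F| ^ k - #|F| ^ \rank A)%N.
  rewrite -in_card -card_rV -cardsT -cardsDS ?subsetT //.
  by apply: eq_card => b; rewrite !inE andbT.
rewrite -out_card -in_card -!sum1dep_card.
rewrite [LHS](bigID (fun b => (b <= A)%MS)) /= !big_distrr /=.
rewrite [X in (X + _)%N]big_mkcondl [X in (_ + X)%N]big_mkcondl /=.
by congr (_ + _)%N; apply: eq_bigr => b; rewrite rank_col_mx_row;
  [move=> -> | move=> nb; rewrite nb]; rewrite ?addn0 ?addn1 muln1; case: eqP.
Qed.

Lemma persymmetric_plus_row_col_mx s k (A : 'M['F_2]_(s, k)) b :
  persymmetric_plus_row (col_mx A b) = persymmetric A.
Proof.
apply/existsP/idP => [[A' /existsP[b' /andP[pA' /eqP/eq_col_mx[-> _]]]] //|pA].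
by exists A; apply/existsP; exists b; rewrite pA eqxx.
Qed.

(** The blocks A and b are determined by the stacked matrix, so the count fibres over A. *)
Lemma Gamma1_sum s k (i : nat) :
  Gamma1 s k i =
  (\sum_(A : 'M_(s, k) | persymmetric A)
     #|[set b : 'rV['F_2]_k | \rank (col_mx A b) == i]|)%N.
Proof.
under eq_bigr => A _ do rewrite -sum1dep_card.
rewrite pair_big_dep /= sum1dep_card.
have inj : injective (fun p : 'M['F_2]_(s, k) * 'rV_k => col_mx p.1 p.2).
  by case=> A b [A' b'] /eq_col_mx[/= -> ->].
rewrite -(card_imset _ inj); apply: eq_card => M; rewrite inE eqz_nat.
apply/idP/imsetP.
  rewrite -[M]vsubmxK persymmetric_plus_row_col_mx => h.
  by exists (usubmx M, dsubmx M); rewrite ?inE.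
by case=> -[A b]; rewrite inE /= => h ->; rewrite persymmetric_plus_row_col_mx.
Qed.

Lemma Gamma1_0 s k : Gamma1 s k 0 = Gamma s k 0.
Proof.
rewrite (Gamma1_sum s k 0) (Gamma_nat s k 0) -sum1dep_card [RHS]big_mkcondr.
apply: eq_bigr => A _; rewrite card_rank_col_mx_row /= addn0.
by case: eqP => // ->.
Qed.

(** Rank i + 1 arises from A of rank i with b outside its row space, or from A of rank i + 1 with b
    inside. *)
Lemma Gamma1S s k i :
  Gamma1 s k i.+1 =
  ((2 ^ k - 2 ^ i) * Gamma s k i + 2 ^ i.+1 * Gamma s k i.+1)%N.
Proof.
rewrite Gamma1_sum !Gamma_nat -!sum1dep_card !big_mkcondr !big_distrr /=.
rewrite -big_split /=; apply: eq_bigr => A _.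
rewrite card_rank_col_mx_row card_Fp // eqSS addnC.
have [->|_] := eqVneq (\rank A) i.
  by rewrite ltn_eqF // muln1 muln0 mul1n.
rewrite !muln0 mul0n; case: eqP => [->|_].
  by rewrite mul1n muln1.
by rewrite mul0n muln0.
Qed.

(** * Closed formulas over the rationals *)

Lemma Gamma1S_rat s k i : (i <= k)%N ->
  (Gamma1 s k i.+1)%:R =
  (2 ^+ k - 2 ^+ i) * (Gamma s k i)%:R + 2 ^+ i.+1 * (Gamma s k i.+1)%:R :> rat.
Proof.
(* [ik] ensures that the subtraction of naturals in [Gamma1S] does not truncate. *)
move=> ik; rewrite Gamma1S natrD !natrM natrB ?leq_exp2l //.
by rewrite !natrX.
Qed.

Lemma GammaS_lt_rat s k r : (r.+1 < minn s k)%N ->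
  (Gamma s k r.+1)%:R = 3 * (2 ^+ r) ^+ 2 :> rat.
Proof. by move=> lt_r; rewrite GammaS_lt // natrM natrX -exprM mulnC exprM. Qed.

Lemma GammaS_full_rat s k r : r.+1 = minn s k ->
  (Gamma s k r.+1)%:R = 2 ^+ (s + k).-1 - (2 ^+ r) ^+ 2 :> rat.
Proof.
move/GammaS_full => /(congr1 (fun l => l%:R : rat)).
by rewrite natrD !natrX -exprM mulnC exprM; lra.
Qed.

Lemma Gamma1_0_eq1 s k : (0 < minn s k)%N -> (Gamma1 s k 0)%:R = 1 :> rat.
Proof. by move=> s0; rewrite Gamma1_0 Gamma0. Qed.

Lemma Gamma1_1_eq s k : (1 < minn s k)%N ->
  (Gamma1 s k 1)%:R = 2 ^+ k + 5 :> rat.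
Proof.
move=> s1; rewrite [LHS](@Gamma1S_rat s k 0) // Gamma0 ?(ltnW s1) //.
by rewrite GammaS_lt_rat // expr0; ring.
Qed.

Lemma Gamma1_lt_eq s k i : (2 <= i < minn s k)%N ->
  (Gamma1 s k i)%:R
  = 3 * 2 ^+ (k + 2 * i - 4) + 21 * 2 ^+ (3 * i - 5) :> rat.
Proof.
case: i => [|[|i]] // /andP[_ lt_i].
rewrite Gamma1S_rat; last by lia.
rewrite !GammaS_lt_rat //; last by lia.
have -> : (k + 2 * i.+2 - 4 = k + i * 2)%N by lia.
have -> : (3 * i.+2 - 5 = i * 3 + 1)%N by lia.
by rewrite !(exprD, exprM, exprS); ring.
Qed.

(** At the full rank of A the recursion combines a generic value of [Gamma] with the full-rank
    one. *)
Lemma Gamma1_min_eq s k i : i.+2 = minn s k ->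
  (Gamma1 s k i.+2)%:R
  = (2 ^+ k - 2 ^+ i.+1) * (3 * (2 ^+ i) ^+ 2)
    + 2 ^+ i.+2 * (2 ^+ (s + k).-1 - (2 ^+ i.+1) ^+ 2) :> rat.
Proof.
move=> ei; rewrite Gamma1S_rat; last by lia.
by rewrite GammaS_lt_rat ?GammaS_full_rat //; lia.
Qed.

(** This rank exceeds the number of rows of A, so A has full rank and b lies outside its row
    space. *)
Lemma Gamma1_succ_row_eq s k : (s < k)%N ->
  (Gamma1 s.+1 k s.+2)%:R
  = (2 ^+ k - 2 ^+ s.+1) * (2 ^+ (s + k) - (2 ^+ s) ^+ 2) :> rat.
Proof.
move=> lt_sk; rewrite Gamma1S_rat // (@Gamma_eq0 _ _ s.+2); last by lia.
by rewrite mulr0 addr0 GammaS_full_rat //; lia.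
Qed.

Theorem theorem1p8 (k m : nat) (hk : (1 <= k)%N) :
  (forall i : nat, (i <= minn k (2 + m))%N ->
     (Gamma1 (1 + m) k i%:Z)%:R
     = (2 ^+ k - 2 ^ (i%:Z - 1)) * (Gamma (1 + m) k (i%:Z - 1))%:R
       + 2 ^+ i * (Gamma (1 + m) k i%:Z)%:R :> rat)
  /\ (k = 2%N ->
      [/\ (Gamma1 (1 + m) 2 0)%:R = 1 :> rat,
          (Gamma1 (1 + m) 2 1)%:R = 9 :> rat
        & (Gamma1 (1 + m) 2 2)%:R = 2 ^+ (4 + m) - 10 :> rat])
  /\ (m = 0%N -> (2 <= k)%N ->
      [/\ (Gamma1 1 k 0)%:R = 1 :> rat,
          (Gamma1 1 k 1)%:R = 3 * (2 ^+ k - 1) :> rat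
        & (Gamma1 1 k 2)%:R = 2 ^+ (2 * k) - 3 * 2 ^+ k + 2 :> rat])
  /\ (m = 1%N -> (3 <= k)%N ->
      [/\ (Gamma1 2 k 0)%:R = 1 :> rat,
          (Gamma1 2 k 1)%:R = 2 ^+ k + 5 :> rat,
          (Gamma1 2 k 2)%:R = 11 * (2 ^+ k - 2) :> rat
        & (Gamma1 2 k 3)%:R
          = 2 ^+ (2 * k + 1) - 3 * 2 ^+ (k + 2) + 2 ^+ 4 :> rat])
  /\ ((3 <= k)%N -> (k <= 1 + m)%N ->
      [/\ (Gamma1 (1 + m) k 0)%:R = 1 :> rat,
          (Gamma1 (1 + m) k 1)%:R = 2 ^+ k + 5 :> rat,
          (forall i : nat, (2 <= i <= k - 1)%N ->
             (Gamma1 (1 + m) k i%:Z)%:R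
             = 3 * 2 ^+ (k + 2 * i - 4) + 21 * 2 ^+ (3 * i - 5) :> rat)
        & (Gamma1 (1 + m) k k%:Z)%:R
          = 2 ^+ (2 * k + m) - 5 * 2 ^+ (3 * k - 5) :> rat])
  /\ ((2 <= m)%N -> (m <= k - 2)%N ->
      [/\ (Gamma1 (1 + m) k 0)%:R = 1 :> rat,
          (Gamma1 (1 + m) k 1)%:R = 2 ^+ k + 5 :> rat,
          (forall i : nat, (2 <= i <= m)%N ->
             (Gamma1 (1 + m) k i%:Z)%:R
             = 3 * 2 ^+ (k + 2 * i - 4) + 21 * 2 ^+ (3 * i - 5) :> rat),
          (Gamma1 (1 + m) k (m + 1)%N%:Z)%:R
          = 11 * (2 ^+ (k + 2 * m - 2) - 2 ^+ (3 * m - 2)) :> rat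
        & (Gamma1 (1 + m) k (m + 2)%N%:Z)%:R
          = 2 ^+ (2 * k + m) - 3 * 2 ^+ (k + 2 * m) + 2 ^+ (3 * m + 1) :> rat]).
Proof.
split; [|split; [|split; [|split; [|split]]]].
- case=> [|i] le_i.
    rewrite Gamma1_0 expr0 mul1r /Gamma.
    (* No rank equals -1, so the first summand vanishes at i = 0. *)
    rewrite (eq_card0 (A := [set A | _ & _ == _ - 1])).
      by rewrite mulr0 add0r.
    by move=> A; rewrite !inE sub0r andbF.
  have -> : i.+1%:Z - 1 = i :> int by lia.
  by rewrite Gamma1S_rat //; lia.
- move=> k2; split; first by apply: Gamma1_0_eq1; lia.
    rewrite [LHS](@Gamma1S_rat _ _ 0) // Gamma0; last by lia.
    (* For m = 0, rank 1 is already full; [Gamma] equals 3 there in both cases. *)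
    case: m => [|m]; last by rewrite GammaS_lt_rat ?expr0; [ring|lia].
    by rewrite GammaS_full_rat.
  case: m => [|m].
    by rewrite [LHS](@Gamma1_succ_row_eq 0).
  rewrite [LHS](@Gamma1_min_eq _ _ 0); last by lia.
  have -> : (1 + m.+1 + 2).-1 = (m + 3)%N by lia.
  by rewrite !(exprD, exprS) expr0; ring.
- move=> m0 k2; split; first by apply: Gamma1_0_eq1; lia.
    rewrite [LHS](@Gamma1S_rat _ _ 0) // Gamma0; last by lia.
    by rewrite GammaS_full_rat ?add1n /=; [ring|lia].
  rewrite [LHS](@Gamma1_succ_row_eq 0) // add0n mulnC exprM.
  by rewrite !exprS expr0; ring.
- move=> m1 k3; split; first by apply: Gamma1_0_eq1; lia.
  + by apply: Gamma1_1_eq; lia.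
  + rewrite [LHS](@Gamma1_min_eq _ _ 0); last by lia.
    by rewrite add2n /= !exprS expr0; ring.
  + rewrite [LHS](@Gamma1_succ_row_eq 1); last by lia.
    rewrite (mulnC 2%N) !exprD exprM.
    by rewrite !exprS expr0; ring.
- move=> k3 le_km; split; first by apply: Gamma1_0_eq1; lia.
  + by apply: Gamma1_1_eq; lia.
  + by move=> i i_bnd; apply: Gamma1_lt_eq; lia.
  (* As k <= 1 + m, the full rank of A is k. *)
  have [i ki] : exists i, k = i.+2 by exists k.-2; lia.
  rewrite ki Gamma1_min_eq; last by lia.
  have -> : (1 + m + i.+2).-1 = (m + i + 2)%N by lia.
  have -> : (2 * i.+2 + m = i * 2 + m + 4)%N by lia.
  have -> : (3 * i.+2 - 5 = i * 3 + 1)%N by lia.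
  by rewrite !(exprD, exprM, exprS) expr0; ring.
- move=> m2 le_mk; split; first by apply: Gamma1_0_eq1; lia.
  + by apply: Gamma1_1_eq; lia.
  + by move=> i i_bnd; apply: Gamma1_lt_eq; lia.
  + have [i mi] : exists i, m = i.+1 by exists m.-1; lia.
    rewrite mi addn1 Gamma1_min_eq; last by lia.
    have -> : (1 + i.+1 + k).-1 = (i + k + 1)%N by lia.
    have -> : (k + 2 * i.+1 - 2 = k + i * 2)%N by lia.
    have -> : (3 * i.+1 - 2 = i * 3 + 1)%N by lia.
    by rewrite !(exprD, exprM, exprS) expr0; ring.
  rewrite addn2 add1n Gamma1_succ_row_eq; last by lia.
  rewrite !(mulnC _ k) !(mulnC _ m) !(exprD, exprM, exprS) expr0; ring.
Qed.
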